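(* Let $R$ be a commutative ring and let $D_1=D_2$ be a $\mathrm{RING}_R$ equation with parameter space $P=R^n$. If $(p_1,\dots,p_n)\in P$ is sound, then $(\phi(p_1),\dots,\phi(p_n))$ is also sound for any ring endomorphism $\phi:R\to R$.
   Context: $\mathrm{RING}_R$ is the compact closed PROP of diagrams generated by wires (interpreted as $I_2$), swap ($|xy\rangle\mapsto|yx\rangle$), cap $(1\ 0\ 0\ 1)$, cup $(1\ 0\ 0\ 1)^T$, states $0\to1$ labelled by $a\in R$ (interpreted as $(1,a)^T$), multiplication $2\to1$ (interpreted as $\begin{pmatrix}1&0&0&0\\0&0&0&1\end{pmatrix}$) and addition $2\to1$ (interpreted as $\begin{pmatrix}1&0&0&0\\0&1&1&0\end{pmatrix}$); the interpretation of a diagram is a matrix over $R$, with composition the matrix product and tensor the Kronecker product. The skeleton of a diagram is the diagram with its labels removed. The parameter space of an equation $D_1=D_2$ is the product, over all labelled nodes in the skeletons of $D_1$ and $D_2$, of the set $R$ of possible labels. A point of the parameter space specifies a label for every labelled node on both sides; it is sound if the two diagrams with these labels have equal interpretations. *)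

(* Defs.v *)
From HB Require Import structures.
From mathcomp Require Import all_boot all_order all_algebra.
From mathcomp.real_closed Require Import mxtens.

Set Implicit Arguments.
Unset Strict Implicit.
Unset Printing Implicit Defensive.

Import GRing.Theory.
Local Open Scope ring_scope.

(* [diagram L m n] is the type of diagrams m -> n whose states carry labels   *)
(* in L. Diagrams are terms over the generators of the compact closed PROP,   *)
(* without quotient by the PROP equations: the interpretation below only      *)
(* depends on the class of a term. Skeletons are diagrams labelled in [unit]. *)
Inductive diagram (L : Type) : nat -> nat -> Type :=
| Empty : diagram L 0 0
| Wire : diagram L 1 1
| Swap : diagram L 2 2
| Cap : diagram L 2 0
| Cup : diagram L 0 2
| State (a : L) : diagram L 0 1
| Mul : diagram L 2 1
| Add : diagram L 2 1
| Comp (m n p : nat) (D2 : diagram L n p) (D1 : diagram L m n) : diagram L m p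
| Tens (m1 n1 m2 n2 : nat) (D1 : diagram L m1 n1) (D2 : diagram L m2 n2) :
    diagram L (m1 + m2)%N (n1 + n2)%N.

Arguments Empty {L}.
Arguments Wire {L}.
Arguments Swap {L}.
Arguments Cap {L}.
Arguments Cup {L}.
Arguments State {L} a.
Arguments Mul {L}.
Arguments Add {L}.

Definition mx_of_rows (R : pzRingType) (m n : nat) (rows : seq (seq R)) :
    'M[R]_(m, n) :=
  \matrix_(i < m, j < n) nth 0 (nth [::] rows i) j.

(* A diagram m -> n is sent to a matrix with 2 ^ n rows and 2 ^ m columns;    *)
(* the basis of the 2 ^ n-dimensional space is ordered lexicographically, as  *)
(* for the Kronecker product [*t].                                            *)
Fixpoint interp (R : comPzRingType) (m n : nat) (D : diagram R m n) :
    'M[R]_(2 ^ n, 2 ^ m) :=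
  match D in diagram _ m n return 'M[R]_(2 ^ n, 2 ^ m) with
  | Empty => 1%:M
  | Wire => 1%:M
  | Swap => mx_of_rows _ _ [:: [:: 1; 0; 0; 0];
                               [:: 0; 0; 1; 0];
                               [:: 0; 1; 0; 0];
                               [:: 0; 0; 0; 1]]
  | Cap => mx_of_rows _ _ [:: [:: 1; 0; 0; 1]]
  | Cup => mx_of_rows _ _ [:: [:: 1]; [:: 0]; [:: 0]; [:: 1]]
  | State a => mx_of_rows _ _ [:: [:: 1]; [:: a]]
  | Mul => mx_of_rows _ _ [:: [:: 1; 0; 0; 0];
                              [:: 0; 0; 0; 1]]
  | Add => mx_of_rows _ _ [:: [:: 1; 0; 0; 0];
                              [:: 0; 1; 1; 0]]
  | Comp _ _ _ D2 D1 => interp D2 *m interp D1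
  | Tens m1 n1 m2 n2 D1 D2 =>
      castmx (esym (expnD 2 n1 n2), esym (expnD 2 m1 m2))
             (interp D1 *t interp D2)
  end.

Fixpoint skeleton (L : Type) (m n : nat) (D : diagram L m n) :
    diagram unit m n :=
  match D in diagram _ m n return diagram unit m n with
  | Empty => Empty
  | Wire => Wire
  | Swap => Swap
  | Cap => Cap
  | Cup => Cup
  | State _ => State tt
  | Mul => Mul
  | Add => Add
  | Comp _ _ _ D2 D1 => Comp (skeleton D2) (skeleton D1)
  | Tens _ _ _ _ D1 D2 => Tens (skeleton D1) (skeleton D2)
  end.

Fixpoint nlabels (L : Type) (m n : nat) (D : diagram L m n) : nat :=
  match D with
  | State _ => 1
  | Comp _ _ _ D2 D1 => nlabels D2 + nlabels D1
  | Tens _ _ _ _ D1 D2 => nlabels D1 + nlabels D2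
  | _ => 0
  end.

(* The labelled nodes of a skeleton S are numbered from 0 to nlabels S - 1 in *)
(* the order in which they occur in the term S.                               *)
Fixpoint fill (L : Type) (m n : nat) (S : diagram unit m n) :
    ('I_(nlabels S) -> L) -> diagram L m n :=
  match S in diagram _ m n return ('I_(nlabels S) -> L) -> diagram L m n with
  | Empty => fun=> Empty
  | Wire => fun=> Wire
  | Swap => fun=> Swap
  | Cap => fun=> Cap
  | Cup => fun=> Cup
  | State _ => fun l => State (l ord0)
  | Mul => fun=> Mul
  | Add => fun=> Add
  | Comp _ _ _ S2 S1 => fun l =>
      Comp (fill (fun i => l (lshift (nlabels S1) i)))
           (fill (fun i => l (rshift (nlabels S2) i)))
  | Tens _ _ _ _ S1 S2 => fun l =>
      Tens (fill (fun i => l (lshift (nlabels S2) i)))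
           (fill (fun i => l (rshift (nlabels S1) i)))
  end.

Record equation (L : Type) (m n : nat) :=
  Equation { lhs : diagram L m n; rhs : diagram L m n }.

Definition nparams (L : Type) (m n : nat) (E : equation L m n) : nat :=
  (nlabels (skeleton (lhs E)) + nlabels (skeleton (rhs E)))%N.

Definition parameter_space (L : Type) (m n : nat) (E : equation L m n) : Type :=
  (nparams E).-tuple L.

Definition lhs_at (L : Type) (m n : nat) (E : equation L m n)
    (p : parameter_space E) : diagram L m n :=
  fill (S := skeleton (lhs E))
       (fun i => tnth p (lshift (nlabels (skeleton (rhs E))) i)).

Definition rhs_at (L : Type) (m n : nat) (E : equation L m n)
    (p : parameter_space E) : diagram L m n :=
  fill (S := skeleton (rhs E))
       (fun i => tnth p (rshift (nlabels (skeleton (lhs E))) i)).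

Definition sound (R : comPzRingType) (m n : nat) (E : equation R m n)
    (p : parameter_space E) : Prop :=
  interp (lhs_at p) = interp (rhs_at p).

(* Main.v *)
(* By induction on a skeleton, the interpretation of a diagram commutes with   *)
(* relabelling along a ring morphism: the matrices of the unlabelled           *)
(* generators have entries 0 and 1, and products and Kronecker products are    *)
(* polynomial in the entries.                                                  *)
Require Import Defs.
From mathcomp Require Import all_boot all_order all_algebra.
From mathcomp.real_closed Require Import mxtens.

Local Open Scope ring_scope.

(** Soundness is an equality of two matrices over [R]. Applying [phi] to every entry preserves it,
    and by [interp_fill_rmorph] turns each side into the interpretation at the relabelled point. *)

Lemma map_mx_of_rows (R S : pzRingType) (f : {rmorphism R -> S}) (m n : nat)
    (rows : seq (seq R)) :
  map_mx f (mx_of_rows m n rows) = mx_of_rows m n (map (map f) rows).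
Proof.
apply/matrixP=> i j; rewrite !mxE.
(* Outside the listed rows and entries [nth] yields the default 0, which [f] fixes. *)
have [lt_i|le_i] := ltnP i (size rows); last first.
  by rewrite !(nth_default [::]) ?size_map // !nth_nil GRing.rmorph0.
rewrite (nth_map [::]) //.
have [lt_j|le_j] := ltnP j (size (nth [::] rows i)); last first.
  by rewrite !(nth_default 0) ?size_map // GRing.rmorph0.
by rewrite (nth_map 0).
Qed.

Lemma interp_fill_rmorph (R S : comPzRingType) (f : {rmorphism R -> S})
    (m n : nat) (D : diagram unit m n) (a : 'I_(nlabels D) -> R)
    (b : 'I_(nlabels D) -> S) :
  b =1 f \o a -> interp (fill b) = map_mx f (interp (fill a)).
Proof.
elim: D a b => {m n} [||||| u |||m n p D2 IH2 D1 IH1|m1 n1 m2 n2 D1 IH1 D2 IH2]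
  a b eq_b /=;
  rewrite ?map_mx1 ?map_mx_of_rows /= ?GRing.rmorph0 ?GRing.rmorph1 //.
- by rewrite eq_b.
- rewrite map_mxM; congr (_ *m _).
  + by apply: IH2 => i; apply: eq_b.
  + by apply: IH1 => i; apply: eq_b.
- rewrite map_castmx map_mxT; congr (castmx _ (_ *t _)).
  + by apply: IH1 => i; apply: eq_b.
  + by apply: IH2 => i; apply: eq_b.
Qed.

Theorem proposition7p36 (R : comPzRingType) (k l : nat) (E : equation R k l)
    (p : parameter_space E) (phi : {rmorphism R -> R}) :
  sound p -> sound ([tuple phi (tnth p i) | i < nparams E] : parameter_space E).
Proof.
rewrite /sound => eq_p.
(* The image under [phi] of the common interpretation at [p] links both sides; the new labels need
   only match [phi] of the old ones pointwise. *)
transitivity (map_mx phi (interp (lhs_at p))); last rewrite eq_p; last symmetry.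
all: by apply: interp_fill_rmorph => i; rewrite tnth_mktuple.
Qed.
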